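(* Let $k$ be a nonnegative integer and $\varphi=\frac{1+\sqrt5}{2}$. For $0<x<\varphi-1$, $$2\prod_{n=1}^{\infty}(1+x^n)-\sum_{n=1}^{\infty}\frac{x^n}{1-x^{2n}}<\frac{1}{x^{k-1}(1+x)^k(1-x-x^2)}-\frac{1}{x^k(1+x)^k}\sum_{n=0}^{2k}\left(F_n-S_{n,k} \right)x^n,$$ where $$S_{n,k}=2\sum_{j=0}^{k}\binom{k}{j}q(n-k-j)-\sum_{j=0}^{k}\binom{k}{j}Q_1(n-k-j).$$
   Context: $q(n)$ denotes the number of partitions of the positive integer $n$ into odd parts; $q(0)=1$ and $q(n)=0$ for negative $n$. For $n\geq1$, $Q_1(n)$ is the number of odd positive divisors of $n$, and $Q_1(n)=0$ for $n\leq 0$. $F_n$ is the $n$-th Fibonacci number: $F_0=0$, $F_1=1$, $F_n=F_{n-1}+F_{n-2}$. *)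

(* Defs.v *)
From HB Require Import structures.
From mathcomp Require Import all_boot all_order all_algebra.
From mathcomp Require Import all_classical all_reals all_analysis.

Set Implicit Arguments.
Unset Strict Implicit.
Unset Printing Implicit Defensive.

Import Order.TTheory GRing.Theory Num.Theory.
Import numFieldNormedType.Exports.

Local Open Scope ring_scope.

(* Partitions of n into odd parts, as non-increasing sequences of odd numbers
   with sum n.  The bounds (at most n parts, each part at most n) hold for
   every partition of n and only serve to make the ambient type finite. *)
Definition odd_partitions (n : nat) : {set n.-bseq 'I_n.+1} :=
  [set s : n.-bseq 'I_n.+1 |
    let p := [seq val i | i <- s] in
    [&& sorted geq p, all odd p & sumn p == n]].

Definition q (z : int) : nat :=
  if z is Posz n then #|odd_partitions n| else 0%N.

(* The value at 0 is separated out because [divisors 0] is not empty. *)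
Definition Q1 (z : int) : nat :=
  if z is Posz n.+1 then count odd (divisors n.+1) else 0%N.

Fixpoint fib (n : nat) : nat :=
  if n is n1.+1 then (if n1 is n2.+1 then fib n1 + fib n2 else 1)%N else 0%N.

Definition Snk (n k : nat) : int :=
  2 * (\sum_(0 <= j < k.+1) 'C(k, j) * q (n%:Z - k%:Z - j%:Z)%R)%N%:Z
  - (\sum_(0 <= j < k.+1) 'C(k, j) * Q1 (n%:Z - k%:Z - j%:Z)%R)%N%:Z.

Definition golden_ratio (R : realType) : R := (1 + Num.sqrt 5) / 2.

Definition partial_prod (R : realType) (x : R) (N : nat) : R :=
  \prod_(1 <= n < N.+1) (1 + x ^+ n).

Definition partial_sum (R : realType) (x : R) (N : nat) : R :=
  \sum_(1 <= n < N.+1) x ^+ n / (1 - x ^+ (2 * n)).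

(* Main.v *)
Require Import Defs.
From HB Require Import structures.
From mathcomp Require Import all_boot all_order all_algebra.
From mathcomp Require Import all_classical all_reals all_analysis.
From mathcomp Require Import zify ring lra.

(* There are F_n compositions of n >= 1 into odd parts.  A partition into odd
   parts is such a composition, and if it is not constant its reversal is
   another one; the constant partitions correspond to the odd divisors of n.
   Hence a(n) := 2 q(n) - Q_1(n) <= F_n for n >= 1, strictly for n = 5.  Since
   S_{n,k+1} = S_{n-1,k} + S_{n-2,k}, this spreads to S_{n,k} <= F_n for
   n > 2k, strictly for n = 2k+5.  The left-hand side of the theorem is the
   generating function A(x) of a(n) (Euler's odd-distinct identity), and
   x^k (1+x)^k A(x) is that of S_{n,k}, so the theorem compares the tails
   n > 2k of this series and of the series x / (1 - x - x^2) of F_n.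
   Only the upper bound of A(x) by the series is needed: partial products are
   bounded by any upper bound of the partial sums of q(n) x^n, and the partial
   sums of Q_1(n) x^n are bounded by those of x^n / (1 - x^{2n}). *)

Set Implicit Arguments.
Unset Strict Implicit.
Unset Printing Implicit Defensive.

Import Order.TTheory GRing.Theory Num.Theory.
Import numFieldNormedType.Exports.

Local Open Scope ring_scope.

(** * Compositions into odd parts and Fibonacci numbers *)

Definition add2_head (s : seq nat) : seq nat :=
  if s is a :: s' then a.+2 :: s' else [::].

(** A first part equal to 1 can be removed, and a larger odd first part can be lowered by 2. The
    empty composition of 0 is left out, in agreement with F_0 = 0. *)
Fixpoint odd_compositions (n : nat) : seq (seq nat) :=
  if n is n1.+1 then
    if n1 is n2.+1 then
      [seq 1%N :: s | s <- odd_compositions n1] ++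
      [seq add2_head s | s <- odd_compositions n2]
    else [:: [:: 1%N]]
  else [::].

Arguments odd_compositions : simpl never.

Lemma odd_compositionsSS n : odd_compositions n.+2 =
  [seq 1%N :: s | s <- odd_compositions n.+1] ++
  [seq add2_head s | s <- odd_compositions n].
Proof. by []. Qed.

Lemma fibSS n : fib n.+2 = (fib n.+1 + fib n)%N.
Proof. by []. Qed.

Lemma nat_ind2 (P : nat -> Prop) :
  P 0%N -> P 1%N -> (forall n, P n -> P n.+1 -> P n.+2) -> forall n, P n.
Proof.
move=> P0 P1 PSS n; suff: P n /\ P n.+1 by case.
by elim: n => // n [Pn Pn1]; split; [|apply: PSS].
Qed.

Lemma size_odd_compositions n : size (odd_compositions n) = fib n.
Proof.
elim/nat_ind2: n => // n IHn IHn1.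
by rewrite odd_compositionsSS fibSS size_cat !size_map IHn IHn1.
Qed.

Lemma mem_odd_compositions n s :
  (s \in odd_compositions n) = [&& (0 < n)%N, all odd s & sumn s == n].
Proof.
elim/nat_ind2: n s => [//|s|n IHn IHn1 s].
  rewrite inE; case: s => [|a [|b s]] //=.
    by rewrite eqseq_cons addn0 !andbT; case: (eqVneq a 1%N) => [->|]; rewrite ?andbF.
  rewrite eqseq_cons andbF; apply/esym/negP => /andP[] /and3P[].
  by case: a b => [|a] [|b] //= _ _ _; rewrite addnS.
rewrite odd_compositionsSS mem_cat; apply/orP/idP.
  case=> /mapP[t].
    by rewrite IHn1 => /and3P[_ to /eqP tn] -> /=; rewrite to tn eqxx.
  rewrite IHn => /and3P[n0 + +] ->; case: t => [|a t] /=; first by case: (n) n0.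
  by rewrite negbK => -> /eqP <- /=; rewrite !addSn.
case: s => [//|[|[|a]] s] //= /andP[so /eqP sn].
  left; apply/mapP; exists s => //; rewrite IHn1 so /=; apply/eqP; lia.
right; apply/mapP; exists (a :: s) => //=.
rewrite IHn /=; move: so; rewrite negbK => /andP[ao ->]; rewrite ao /=.
apply/andP; split; last by apply/eqP; lia.
by case: a ao sn => [//|a] _; lia.
Qed.

Lemma uniq_odd_compositions n : uniq (odd_compositions n).
Proof.
elim/nat_ind2: n => // n IHn IHn1.
rewrite odd_compositionsSS cat_uniq !map_inj_in_uniq ?IHn ?IHn1 ?andbT /=.
- apply/hasPn => _ /mapP[s /[!mem_odd_compositions] /and3P[n0 so sn] ->].
  apply/negP => /mapP[t _]; case: s so sn => [|[|a] s] //=.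
- move=> [|a s] [|b t]; rewrite !mem_odd_compositions //=.
  by move=> _ _ [-> ->].
- by move=> s t _ _ [].
Qed.

(** * Partitions into odd parts and their comparison with F_n *)

Definition odd_parts (n : nat) : seq (seq nat) :=
  if n is 0%N then [:: [::]] else [seq s <- odd_compositions n | sorted geq s].

Arguments odd_parts : simpl never.

Lemma mem_odd_parts n s :
  (s \in odd_parts n) = [&& sorted geq s, all odd s & sumn s == n].
Proof.
case: n => [|n]; last by rewrite mem_filter mem_odd_compositions.
rewrite inE; case: s => [//|[|a] s] /=; rewrite ?andbF //.
Qed.

Lemma mem_filter_odd_parts (p : pred (seq nat)) n s :
  (s \in [seq t <- odd_parts n | p t]) =
  [&& p s, sorted geq s, all odd s & sumn s == n].
Proof. by rewrite mem_filter mem_odd_parts. Qed.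

Lemma uniq_odd_parts n : uniq (odd_parts n).
Proof. by case: n => // n; rewrite filter_uniq // uniq_odd_compositions. Qed.

Lemma leq_sumn (s : seq nat) a : a \in s -> (a <= sumn s)%N.
Proof.
elim: s => //= b s IHs; rewrite inE => /orP[/eqP -> |/IHs]; first exact: leq_addr.
by move=> /leq_trans; apply; exact: leq_addl.
Qed.

Lemma size_le_sumn (s : seq nat) : all odd s -> (size s <= sumn s)%N.
Proof. by elim: s => //= -[//|a] s IHs /andP[_ /IHs]; lia. Qed.

Lemma q_odd_parts n : q n%:Z = size (odd_parts n).
Proof.
rewrite /q cardE.
pose f (s : n.-bseq 'I_n.+1) := [seq val i | i <- s].
have finj : injective f by move=> s t /(inj_map val_inj) /val_inj.
rewrite -(size_map f); apply/perm_size/uniq_perm.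
- by rewrite map_inj_uniq // enum_uniq.
- exact: uniq_odd_parts.
move=> s; rewrite mem_odd_parts; apply/mapP/idP.
  by case=> t; rewrite mem_enum inE => + ->.
move=> /[dup] hs /and3P[_ so /eqP sn].
have sb : (size [seq inord i : 'I_n.+1 | i <- s] <= n)%N.
  by rewrite size_map -sn size_le_sumn.
have E : s = f (Bseq sb).
  rewrite /f /= -map_comp -[LHS]map_id; apply/eq_in_map => i si /=.
  by rewrite inordK // ltnS -sn leq_sumn.
by exists (Bseq sb) => //; rewrite mem_enum inE -[map _ _]/(f _) -E.
Qed.

(** The head is both the largest and the smallest entry. *)
Lemma sorted_geq_rev_constant (s : seq nat) :
  sorted geq s -> sorted geq (rev s) -> constant s.
Proof.
case: s => [//|a s] sa; rewrite rev_sorted.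
move=> /= sb; apply/allP => b bs /=.
have /allP/(_ _ bs) /= h1 := order_path_min (rev_trans leq_trans) sa.
have /allP/(_ _ bs) /= h2 := order_path_min leq_trans sb.
by rewrite eqn_leq; apply/andP; split.
Qed.

Lemma constantE (T : eqType) (a : T) s : constant (a :: s) -> s = nseq (size s) a.
Proof. by move=> /= /all_pred1P. Qed.

(** For a fixed sum, a constant partition is determined by its repeated part, which is an odd
    divisor; [head] is therefore injective here. *)
Lemma constant_odd_parts_le n : (count constant (odd_parts n.+1) <= Q1 n.+1%:Z)%N.
Proof.
rewrite /Q1 -!size_filter -(size_map (head 0%N)); apply: uniq_leq_size.
  rewrite map_inj_in_uniq ?(filter_uniq _ (uniq_odd_parts _)) // => s t.
  rewrite !mem_filter_odd_parts => /and4P[cs _ so /eqP sn] /and4P[ct _ t_o /eqP tn].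
  case: s t cs ct so sn t_o tn => [|a s] [|b t] // /constantE -> /constantE ->.
  move=> /= /andP[ao _] sn _ tn ab; subst b; congr (_ :: nseq _ _).
  move: sn tn; rewrite !sumn_nseq => <- /eqP.
  rewrite eqn_add2l eqn_pmul2l; first by move/eqP.
  by case: (a) ao.
move=> _ /mapP[s + ->]; rewrite mem_filter_odd_parts => /and4P[cs _ so /eqP sn].
case: s cs so sn => [|a s] // /constantE -> /= /andP[ao _] sn.
rewrite mem_filter ao -dvdn_divisors // -sn sumn_nseq.
by rewrite dvdn_addr // dvdn_mulr.
Qed.

Lemma odd_parts_fib n :
  (2 * q n.+1%:Z + (n.+1 == 5) <= fib n.+1 + Q1 n.+1%:Z)%N.
Proof.
rewrite q_odd_parts.
(* The composition 1 + 3 + 1 is monotone in neither direction, which gives the extra unit: 2 * 3 + 1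
   = 5 + 2. *)
have [->|n5] := eqVneq n.+1 5%N; first by vm_compute.
rewrite addn0 mul2n -addnn.
apply: leq_trans (leq_add (leqnn _) (constant_odd_parts_le n)).
(* The second copy of the partitions is split: constant ones cancel against the odd divisors, the
   others are replaced by their reversals. *)
rewrite -[X in (_ + X <= _)%N](count_predC constant) addnA addnAC leq_add2r.
rewrite -size_odd_compositions -size_filter.
rewrite -[X in (_ + X <= _)%N](size_map rev) -size_cat.
apply: uniq_leq_size.
  rewrite cat_uniq uniq_odd_parts map_inj_uniq
    ?(filter_uniq _ (uniq_odd_parts _)) ?andbT //=.
    apply/hasPn => _ /mapP[s + ->]; rewrite mem_filter_odd_parts ?mem_odd_parts /=.
    move=> /and3P[cs ss _]; apply: contra cs => /andP[rs _].
    exact: sorted_geq_rev_constant.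
  exact: can_inj revK.
move=> s; rewrite mem_cat => /orP[|/mapP[t]].
  by rewrite mem_odd_parts mem_odd_compositions => /and3P[_ -> ->].
rewrite mem_filter_odd_parts mem_odd_compositions => /and4P[_ _ to tn] ->.
by rewrite all_rev to /= sumn_rev.
Qed.

(** * Partitions into odd parts of bounded size *)

Definition bounded_odd_parts (N n : nat) : nat :=
  count (all (fun a => (a <= N)%N)) (odd_parts n).

Lemma bounded_odd_parts_q N n : (bounded_odd_parts N n <= q n%:Z)%N.
Proof. by rewrite q_odd_parts count_size. Qed.

Lemma bounded_odd_partsS N n :
  (bounded_odd_parts N n <= bounded_odd_parts N.+1 n)%N.
Proof. by apply: sub_count => s; apply: sub_all => a; exact: leqW. Qed.

(** Either no part equals [N.+1], or the partition arises by prepending a part [N.+1], which keeps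
    it non-increasing. *)
Lemma bounded_odd_parts_rec N n : odd N.+1 ->
  (bounded_odd_parts N (N.+1 + n) + bounded_odd_parts N.+1 n
   <= bounded_odd_parts N.+1 (N.+1 + n))%N.
Proof.
move=> No; rewrite /bounded_odd_parts -!size_filter.
rewrite -[X in (_ + X <= _)%N](size_map (cons N.+1)) -size_cat.
apply: uniq_leq_size.
  rewrite cat_uniq map_inj_uniq ?(filter_uniq _ (uniq_odd_parts _)) ?andbT //=;
    last by move=> s t [].
  apply/hasPn => _ /mapP[s _ ->]; rewrite mem_filter_odd_parts /= ltnn !andFb //.
move=> s; rewrite mem_cat => /orP[|/mapP[t]]; rewrite !mem_filter_odd_parts.
  by move=> /andP[+ ->]; rewrite andbT; apply: sub_all => a; exact: leqW.
move=> /and4P[tN ts to /eqP tn] -> /=.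
rewrite leqnn tN to tn eqxx !andbT; move: No => /= ->; rewrite andbT.
by rewrite path_sortedE ?ts ?andbT //; exact: rev_trans leq_trans.
Qed.

(** * Bounds for Euler's product and for the Lambert series of odd divisors *)

Section RealSeries.
Variables (R : realType) (x : R).
Hypotheses (x_gt0 : 0 < x) (x_lt1 : x < 1).

Let xn_ge0 n : 0 <= x ^+ n. Proof. by rewrite exprn_ge0 // ltW. Qed.
Let xn_gt0 n : 0 < x ^+ n. Proof. by rewrite exprn_gt0. Qed.
Let xn_lt1 n : x ^+ n.+1 < 1. Proof. by rewrite exprn_ilt1 // ltW. Qed.

Lemma nondecreasing_bounded_cvgn (u : nat -> R) (B : R) :
  (forall n, u n <= u n.+1) -> (forall n, u n <= B) ->
  [/\ cvgn u, forall n, u n <= limn u & limn u <= B].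
Proof.
move=> /nondecreasing_seqP mu uB.
have cu : cvgn u by apply: nondecreasing_is_cvgn => //; exists B => _ [n _ <-].
split=> //; first exact: nondecreasing_cvgn_le.
by apply: limr_le => //; exact: nearW.
Qed.

Let odd_prod N : R := \prod_(1 <= m < N.+1) (if odd m then 1 - x ^+ m else 1).

Let odd_prodS N : odd_prod N.+1 = odd_prod N * (if odd N.+1 then 1 - x ^+ N.+1 else 1).
Proof. by rewrite /odd_prod big_nat_recr. Qed.

Lemma partial_prodS N : partial_prod x N.+1 = partial_prod x N * (1 + x ^+ N.+1).
Proof. by rewrite /partial_prod big_nat_recr. Qed.

Let odd_prod_gt0 N : 0 < odd_prod N.
Proof.
elim: N => [|N IH]; first by rewrite /odd_prod big_geq.
rewrite odd_prodS mulr_gt0 //; case: ifP => // _; rewrite subr_gt0; exact: xn_lt1.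
Qed.

Let even_prod N : R := \prod_(1 <= n < N.+1) (1 - x ^+ (n + n)).

Let even_prodS N : even_prod N.+1 = even_prod N * (1 - x ^+ (N.+1 + N.+1)).
Proof. by rewrite /even_prod big_nat_recr. Qed.

Let even_prod_gt0 N : 0 < even_prod N.
Proof.
elim: N => [|N IH]; first by rewrite /even_prod big_geq.
by rewrite even_prodS mulr_gt0 // subr_gt0 addSn; exact: xn_lt1.
Qed.

(* Finite form of Euler's identity: the factor [1 - x ^+ (2 * n)] telescopes
   between [(1 + x ^+ n) * (1 - x ^+ n)] and the even part of the product. *)
Let euler_finite N :
  partial_prod x N * odd_prod N * even_prod N./2 = even_prod N.
Proof.
elim: N => [|N IH]; first by rewrite /partial_prod /odd_prod /even_prod !big_geq ?mulr1.
rewrite partial_prodS odd_prodS even_prodS -IH /= exprD uphalf_half.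
case: ifPn => No; first by rewrite (negbTE No) add0n; ring.
have {}No : odd N by rewrite negbK in No.
rewrite No add1n even_prodS.
have -> : (N./2.+1 + N./2.+1 = N.+1)%N by have := odd_double_half N; lia.
by ring.
Qed.

(** By the finite Euler identity the left side is [even_prod N / even_prod N./2], and [even_prod] is
    non-increasing. *)
Let partial_prod_odd_prod_le1 N : partial_prod x N * odd_prod N <= 1.
Proof.
rewrite -(ler_pM2r (even_prod_gt0 N./2)) euler_finite mul1r.
have mono : {homo even_prod : m n / (m <= n)%N >-> n <= m}.
  apply: (@homo_leq _ _ (fun a b => b <= a)) => // [a b c ab bc|n].
    exact: le_trans bc ab.
  by rewrite even_prodS ler_piMr ?gerBl ?xn_ge0 // ltW // even_prod_gt0.
by apply: mono; lia.
Qed.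

(** Truncations of the power series of [1 / odd_prod N]. *)
Let T N M : R := \sum_(0 <= n < M) (bounded_odd_parts N n)%:R * x ^+ n.

Let T_mono N M : T N M <= T N M.+1.
Proof. by rewrite /T big_nat_recr //= lerDl mulr_ge0. Qed.

Let T_rec N M : odd N.+1 -> T N (N.+1 + M) + x ^+ N.+1 * T N.+1 M <= T N.+1 (N.+1 + M).
Proof.
move=> No; rewrite /T (big_cat_nat (n := N.+1)) ?leq_addr //=.
rewrite [leRHS](big_cat_nat (n := N.+1)) ?leq_addr //= -addrA lerD //.
  by apply: ler_sum => n _; rewrite ler_wpM2r // ler_nat bounded_odd_partsS.
rewrite -{1 5}[N.+1]add0n ![(N.+1 + M)%N]addnC !big_addn !addnK.
rewrite mulr_sumr -big_split /=; apply: ler_sum => n _.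
have := bounded_odd_parts_rec n No.
rewrite -(ler_nat R) natrD (addnC N.+1) => h; rewrite exprD.
apply: le_trans (ler_wpM2r (mulr_ge0 (xn_ge0 n) (xn_ge0 N.+1)) h).
by rewrite le_eqVlt; apply/orP; left; apply/eqP; ring.
Qed.

Let T_le N M : T N M <= T N.+1 M.
Proof.
by apply: ler_sum => n _; rewrite ler_wpM2r // ler_nat bounded_odd_partsS.
Qed.

(** Induction with [B] varying: passing from [N.+1] to [N] for odd [N.+1] turns the bound [B] into
    [B * (1 - x ^+ N.+1)]. *)
Let odd_prod_ge B N : (forall M, T N M <= B) -> 1 <= B * odd_prod N.
Proof.
elim: N B => [|N IH] B TB.
  rewrite /odd_prod big_geq // mulr1; apply: le_trans (TB 1%N).
  by rewrite /T big_nat1 expr0 mulr1 ler1n.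
rewrite odd_prodS; case: ifP => No; last first.
  by rewrite mulr1; apply: IH => M; apply: le_trans (T_le _ _) _.
rewrite [odd_prod N * _]mulrC mulrA; apply: IH => M.
have [_ Tlim limB] := nondecreasing_bounded_cvgn (T_mono N.+1) TB.
set S := limn _ in Tlim limB.
suff h : T N M <= S * (1 - x ^+ N.+1).
  by apply: le_trans h _; rewrite ler_wpM2r // subr_ge0 ltW //; exact: xn_lt1.
have mT K : {homo T K : m n / (m <= n)%N >-> m <= n}.
  by apply/nondecreasing_seqP; exact: T_mono.
(* This bounds the limit [S] in terms of itself: [S <= (S - T N M) / x ^+ N.+1], which rearranges to
   the claim. *)
suff [_ _ h] : [/\ cvgn (T N.+1), forall n, T N.+1 n <= limn (T N.+1) &
    limn (T N.+1) <= (S - T N M) / x ^+ N.+1].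
  by move: h; rewrite ler_pdivlMr // -/S; lra.
apply: nondecreasing_bounded_cvgn (T_mono N.+1) _ => M'.
rewrite ler_pdivlMr //.
(* With the maximum, a single use of the recursion covers both truncations. *)
have h1 := T_rec (maxn M M') No; have h2 := Tlim (N.+1 + maxn M M')%N.
have h3 : T N M <= T N (N.+1 + maxn M M') by apply: mT; lia.
have h4 : T N.+1 M' <= T N.+1 (maxn M M') by apply: mT; lia.
have h5 := ler_wpM2l (xn_ge0 N.+1) h4.
by rewrite mulrC; lra.
Qed.

(** Both sides are compared after multiplication by [odd_prod N], with 1 in between. *)
Lemma partial_prod_le B N :
  (forall M, \sum_(0 <= n < M) (q n%:Z)%:R * x ^+ n <= B) -> partial_prod x N <= B.
Proof.
move=> qB; rewrite -(ler_pM2r (odd_prod_gt0 N)).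
apply: le_trans (partial_prod_odd_prod_le1 N) _; apply: odd_prod_ge => M.
apply: le_trans (qB M); apply: ler_sum => n _.
by rewrite ler_wpM2r // ler_nat bounded_odd_parts_q.
Qed.

Lemma partial_prod_nondecreasing N : partial_prod x N <= partial_prod x N.+1.
Proof.
rewrite partial_prodS ler_peMr ?lerDl //.
by apply: prodr_ge0 => n _; rewrite addr_ge0.
Qed.

Lemma partial_sumS N :
  partial_sum x N.+1 = partial_sum x N + x ^+ N.+1 / (1 - x ^+ (2 * N.+1)).
Proof. by rewrite /partial_sum big_nat_recr. Qed.

Let den_gt0 n : 0 < 1 - x ^+ (2 * n.+1).
Proof. by rewrite mulnS addSn subr_gt0; exact: xn_lt1. Qed.

Lemma partial_sum_nondecreasing N : partial_sum x N <= partial_sum x N.+1.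
Proof. by rewrite partial_sumS lerDl divr_ge0 // ltW. Qed.

Lemma partial_sum_bounded N : partial_sum x N <= ((1 - x) * (1 - x ^+ 2))^-1.
Proof.
have x1 : 0 < 1 - x by rewrite subr_gt0.
have x2 : 0 < 1 - x ^+ 2 by rewrite subr_gt0; exact: xn_lt1.
(* The n-th term is at most [x ^+ n.-1 / (1 - x ^+ 2)]; the factor [1 - x ^+ N] comes from the
   finite geometric sum. *)
suff h : partial_sum x N <= (1 - x ^+ N) * ((1 - x) * (1 - x ^+ 2))^-1.
  by apply: le_trans h _; rewrite ler_piMl ?gerBl // invr_ge0 mulr_ge0 ?ltW.
elim: N => [|N IH]; first by rewrite /partial_sum big_geq // expr0 subrr mul0r.
rewrite partial_sumS.
have h : x ^+ N.+1 / (1 - x ^+ (2 * N.+1)) <= x ^+ N / (1 - x ^+ 2).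
  apply: ler_pM => //; first by rewrite invr_ge0 ltW.
    by rewrite exprS ler_piMl // ltW.
  rewrite lef_pV2 ?posrE // lerB // mulnS exprD ler_piMr //.
  by rewrite exprn_ile1 // ltW.
apply: le_trans (lerD IH h) _.
rewrite le_eqVlt; apply/orP; left; apply/eqP; rewrite [x ^+ N.+1]exprS; field.
by rewrite !lt0r_neq0.
Qed.

(** Each odd divisor 2i+1 of [M] is paired with its cofactor n. *)
Lemma Q1_le_sum M N : (M <= N)%N ->
  (Q1 M%:Z <= \sum_(1 <= n < N.+1) \sum_(0 <= i < N) (M == n * i.*2.+1))%N.
Proof.
case: M => [//|M] MN; rewrite exchange_big /=.
apply: (@leq_trans (\sum_(0 <= i < N | i.*2.+1 %| M.+1) 1)%N).
  rewrite sum1_count -!size_filter -[leqRHS](size_map (fun i => i.*2.+1)).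
  apply: uniq_leq_size; first by rewrite filter_uniq ?divisors_uniq.
  move=> d; rewrite mem_filter -dvdn_divisors // => /andP[d_odd dM].
  have dE : d = d./2.*2.+1 by have := odd_double_half d; rewrite d_odd; lia.
  apply/mapP; exists d./2 => //; rewrite mem_filter -dE dM mem_index_iota /=.
  by have := dvdn_leq (ltn0Sn M) dM; lia.
rewrite big_mkcond /=; apply: leq_sum => i _; case: ifP => // /dvdnP[n Mn].
rewrite (bigD1_seq n) ?iota_uniq //= ?Mn ?eqxx ?leq_addr //.
rewrite mem_index_iota; case: n Mn => [//|n] Mn; apply/andP; split=> //.
by rewrite ltnS (leq_trans _ MN) // Mn leq_pmulr.
Qed.

(** After exchanging sums, the n-th inner sum is a piece of the geometric series of x^n / (1 -
    x^{2n}) with exponents n(2i+1). *)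
Lemma sum_Q1_le_partial_sum N :
  \sum_(0 <= M < N.+1) (Q1 M%:Z)%:R * x ^+ M <= partial_sum x N.
Proof.
apply: (@le_trans _ _ (\sum_(0 <= M < N.+1)
    \sum_(1 <= n < N.+1) \sum_(0 <= i < N) (M == n * i.*2.+1)%N%:R * x ^+ M)).
  rewrite !big_nat; apply: ler_sum => M /= MN.
  under eq_bigr do rewrite -mulr_suml.
  rewrite -mulr_suml ler_wpM2r //.
  under eq_bigr do rewrite -natr_sum.
  by rewrite -natr_sum ler_nat Q1_le_sum.
rewrite exchange_big /= /partial_sum !big_nat; apply: ler_sum => n /andP[n0 _].
rewrite exchange_big /=.
apply: (@le_trans _ _ (\sum_(0 <= i < N) x ^+ (n * i.*2.+1))).
  apply: ler_sum => i _.
  have [nN|nN] := ltnP (n * i.*2.+1) N.+1.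
    rewrite (bigD1_seq (n * i.*2.+1)%N) ?iota_uniq ?mem_index_iota //= eqxx mul1r.
    rewrite big1 ?addr0 // => M; rewrite eq_sym => /negbTE ->; exact: mul0r.
  rewrite big_nat big1 // => M /andP[_ MN].
  have /negbTE -> : M != (n * i.*2.+1)%N by apply/eqP; lia.
  exact: mul0r.
case: n n0 => [//|n] _; rewrite ler_pdivlMr //.
suff -> : (\sum_(0 <= i < N) x ^+ (n.+1 * i.*2.+1)) * (1 - x ^+ (2 * n.+1)) =
    x ^+ n.+1 * (1 - x ^+ (2 * n.+1 * N)) by rewrite ler_piMr // gerBl.
elim: N => [|N IH]; first by rewrite big_geq // muln0 expr0 subrr mulr0 mul0r.
rewrite big_nat_recr //= mulrDl IH.
have -> : (n.+1 * N.*2.+1 = n.+1 + 2 * n.+1 * N)%N by lia.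
have -> : (2 * n.+1 * N.+1 = 2 * n.+1 + 2 * n.+1 * N)%N by lia.
by rewrite !exprD; ring.
Qed.

End RealSeries.

(** * The integers F_n - S_{n,k}: recurrence and signs *)

(** The coefficient of x^z in x^k (1+x)^k times the generating function of [f]. *)
Definition binomial_shift (f : int -> nat) (z : int) (k : nat) : nat :=
  (\sum_(0 <= j < k.+1) 'C(k, j) * f (z - k%:Z - j%:Z)%R)%N.

Lemma SnkE n k :
  Snk n k = 2 * (binomial_shift q n%:Z k)%:Z - (binomial_shift Q1 n%:Z k)%:Z.
Proof. by []. Qed.

(** Pascal's rule, that is, multiplication by one more factor x + x^2. *)
Lemma binomial_shiftS f z k : binomial_shift f z k.+1 =
  (binomial_shift f (z - 1) k + binomial_shift f (z - 2) k)%N.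
Proof.
rewrite /binomial_shift big_nat_recl //= bin0.
under eq_bigr do rewrite binS mulnDl.
rewrite big_split /= addnA; congr addn.
  rewrite -(bin0 k) -[LHS](big_nat_recl _ _
    (fun j => 'C(k, j) * f (z - k.+1%:Z - j%:Z)%R)%N) //.
  rewrite big_nat_recr //= bin_small // mul0n addn0.
  by apply: eq_bigr => j _; congr (_ * f _)%N; lia.
by apply: eq_bigr => j _; congr (_ * f _)%N; lia.
Qed.

Lemma binomial_shift_lt0 f z k : (forall y, y < 0 -> f y = 0%N) -> z < 0 ->
  binomial_shift f z k = 0%N.
Proof.
by move=> f0 z0; rewrite /binomial_shift big1 // => j _; rewrite f0 ?muln0 //; lia.
Qed.

Lemma binomial_shift0 f z : binomial_shift f z 0 = f z.
Proof. by rewrite /binomial_shift big_nat1 bin0 mul1n !subr0. Qed.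

Lemma q_lt0 (y : int) : y < 0 -> q y = 0%N. Proof. by case: y. Qed.

Lemma Q1_lt0 (y : int) : y < 0 -> Q1 y = 0%N. Proof. by case: y. Qed.

Definition fib_gap (k n : nat) : int := (fib n)%:Z - Snk n k.

Lemma fib_gap0S k : fib_gap k.+1 0 = 0.
Proof.
rewrite /fib_gap SnkE !binomial_shiftS.
by rewrite !(binomial_shift_lt0 _ q_lt0) // !(binomial_shift_lt0 _ Q1_lt0).
Qed.

(** The summand 1 is F_1 - F_0, the defect of the Fibonacci recurrence at its start. *)
Lemma fib_gap1S k : fib_gap k.+1 1 = 1 + fib_gap k 0.
Proof.
rewrite /fib_gap !SnkE !binomial_shiftS.
rewrite (binomial_shift_lt0 (z := 1 - 2) k q_lt0) //.
by rewrite (binomial_shift_lt0 (z := 1 - 2) k Q1_lt0) // subrr !addn0 addrA.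
Qed.

Lemma fib_gapSS k n : fib_gap k.+1 n.+2 = fib_gap k n.+1 + fib_gap k n.
Proof.
rewrite /fib_gap !SnkE fibSS !binomial_shiftS.
have -> : n.+2%:Z - 1 = n.+1%:Z by lia.
have -> : n.+2%:Z - 2 = n%:Z by lia.
lia.
Qed.

Lemma fib_gap_k0 n : fib_gap 0 n = (fib n)%:Z - (2 * (q n%:Z)%:Z - (Q1 n%:Z)%:Z).
Proof. by rewrite /fib_gap SnkE !binomial_shift0. Qed.

Lemma fib_gap_ge0 k n : (2 * k < n)%N -> 0 <= fib_gap k n.
Proof.
elim: k n => [|k IH] [|n] //; last first.
  by case: n => [|n] ?; [lia|rewrite fib_gapSS addr_ge0 // IH //; lia].
by rewrite fib_gap_k0; have := odd_parts_fib n; lia.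
Qed.

(** The strict case n = 5 moves up by 2 with each step in [k], through the second summand of
    [fib_gapSS]. *)
Lemma fib_gap_gt0 k : 0 < fib_gap k (2 * k + 5).
Proof.
elim: k => [|k IH].
  by rewrite muln0 add0n fib_gap_k0; have := odd_parts_fib 4; rewrite eqxx; lia.
have -> : (2 * k.+1 + 5 = (2 * k + 5).+2)%N by lia.
by rewrite fib_gapSS ltr_wpDl // fib_gap_ge0; lia.
Qed.

(** * Generating functions of the gaps *)

Section FibGapSeries.
Variables (R : realType) (x : R).
Hypotheses (x_gt0 : 0 < x) (x_small : 0 < 1 - x - x ^+ 2).

Let xn_ge0 n : 0 <= x ^+ n. Proof. by rewrite exprn_ge0 // ltW. Qed.

Let x_lt1 : x < 1.
Proof. by move: x_small (xn_ge0 2); lra. Qed.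

Definition gap_sum k M : R := \sum_(0 <= n < M) (fib_gap k n)%:~R * x ^+ n.

Lemma gap_sumS k M : gap_sum k M.+1 = gap_sum k M + (fib_gap k M)%:~R * x ^+ M.
Proof. by rewrite /gap_sum big_nat_recr. Qed.

Lemma gap_sum_rec k M :
  gap_sum k.+1 M.+2 = x + x * gap_sum k M.+1 + x ^+ 2 * gap_sum k M.
Proof.
elim: M => [|M IH].
  rewrite !gap_sumS /gap_sum !big_geq // fib_gap0S fib_gap1S intrD; ring.
rewrite gap_sumS IH !gap_sumS fib_gapSS intrD !exprS; ring.
Qed.

Lemma fib_sum_le N : \sum_(0 <= n < N.+1) (fib n)%:R * x ^+ n <= x / (1 - x - x ^+ 2).
Proof.
rewrite ler_pdivlMr //.
(* Multiplication by the denominator telescopes, leaving two non-negative boundary terms to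
   subtract. *)
suff -> : (\sum_(0 <= n < N.+1) (fib n)%:R * x ^+ n) * (1 - x - x ^+ 2) =
    x - (fib N.+1)%:R * x ^+ N.+1 - (fib N)%:R * x ^+ N.+2.
  by rewrite -addrA gerDl -opprD oppr_le0 addr_ge0 // mulr_ge0.
elim: N => [|N IH]; first by rewrite big_nat1 /= !mul0r mul1r subr0 subrr.
by rewrite fibSS big_nat_recr // [LHS]mulrDl IH natrD !exprS; ring.
Qed.

Let PS := partial_sum_nondecreasing x_gt0 x_lt1.

Lemma partial_sum_cvg : cvgn (partial_sum x).
Proof.
by have [] := nondecreasing_bounded_cvgn PS (partial_sum_bounded x_gt0 x_lt1).
Qed.

(** The sum over [q] is solved for in the gap sum. With [0 < M] the only negative gap, -2 at n = 0,
    already lies in [gap_sum 0 M], so longer gap sums are no smaller. *)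
Lemma sum_q_le M K : (0 < M)%N ->
  \sum_(0 <= n < K) (q n%:Z)%:R * x ^+ n
    <= (limn (partial_sum x) + x / (1 - x - x ^+ 2) - gap_sum 0 M) / 2.
Proof.
move=> M0; set N := (maxn M K).-1.
have NE : N.+1 = maxn M K by rewrite /N; lia.
apply: (@le_trans _ _ (\sum_(0 <= n < N.+1) (q n%:Z)%:R * x ^+ n)).
  rewrite [leRHS](big_cat_nat (n := K)) ?lerDl //=; last by lia.
  by apply: sumr_ge0 => n _; rewrite mulr_ge0.
have h1 : gap_sum 0 M <= gap_sum 0 N.+1.
  rewrite /gap_sum [leRHS](big_cat_nat (n := M)) ?lerDl //=; last by lia.
  rewrite big_nat; apply: sumr_ge0 => n /andP[Mn _]; rewrite mulr_ge0 // ler0z.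
  by apply: fib_gap_ge0; lia.
have h2 : \sum_(0 <= n < N.+1) (Q1 n%:Z)%:R * x ^+ n <= limn (partial_sum x).
  apply: le_trans (sum_Q1_le_partial_sum x_gt0 x_lt1 N) _.
  by have [_ + _] := nondecreasing_bounded_cvgn PS (partial_sum_bounded x_gt0 x_lt1).
have h3 := fib_sum_le N.
have : gap_sum 0 N.+1 = \sum_(0 <= n < N.+1) (fib n)%:R * x ^+ n
   - 2 * \sum_(0 <= n < N.+1) (q n%:Z)%:R * x ^+ n
   + \sum_(0 <= n < N.+1) (Q1 n%:Z)%:R * x ^+ n.
  rewrite mulr_sumr -sumrB -big_split; apply: eq_bigr => n _; rewrite fib_gap_k0.
  by move: (q n%:Z) (Q1 n%:Z) (fib n) => a b c; rewrite !rmorphB /= rmorphM /=; ring.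
by rewrite ler_pdivlMr //; lra.
Qed.

Lemma partial_prod_cvg_le M : (0 < M)%N -> cvgn (partial_prod x) /\
  2 * limn (partial_prod x) - limn (partial_sum x)
    <= x / (1 - x - x ^+ 2) - gap_sum 0 M.
Proof.
move=> M0; have PB N := partial_prod_le x_gt0 x_lt1 N (fun K => sum_q_le K M0).
have [? _ h] := nondecreasing_bounded_cvgn (partial_prod_nondecreasing x_gt0) PB.
by split=> //; move: h; rewrite ler_pdivlMr //; lra.
Qed.

(** Induction on [k]: multiplying by x + x^2 matches [gap_sum_rec], and its extra term x is absorbed
    by F = x + xF + x^2 F. *)
Lemma gap_sum_bound k M : (2 * k < M)%N ->
  x ^+ k * (1 + x) ^+ k * (2 * limn (partial_prod x) - limn (partial_sum x))
    <= x / (1 - x - x ^+ 2) - gap_sum k M.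
Proof.
set A := 2 * _ - _; set F := x / _.
elim: k M => [|k IH] M kM.
  by rewrite !expr0 !mul1r; have [] := partial_prod_cvg_le kM.
case: M kM => [|[|M]] kM; [lia|lia|rewrite gap_sum_rec].
have FE : F = x + x * F + x ^+ 2 * F by rewrite /F; field; exact: lt0r_neq0.
have /(ler_wpM2l (ltW x_gt0)) h1 := IH M.+1 ltac:(lia).
have /(ler_wpM2l (xn_ge0 2)) h2 := IH M ltac:(lia).
set E := x ^+ k * (1 + x) ^+ k * A in h1 h2.
have -> : x ^+ k.+1 * (1 + x) ^+ k.+1 * A = x * E + x ^+ 2 * E.
  by rewrite /E [x ^+ k.+1]exprS [(1 + x) ^+ k.+1]exprS; ring.
apply: le_trans (lerD h1 h2) _; rewrite [F in leRHS]FE.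
by rewrite le_eqVlt; apply/orP; left; apply/eqP; ring.
Qed.

Lemma gap_sum_lt k : gap_sum k (2 * k).+1 < gap_sum k (2 * k).+1.+4.+1.
Proof.
have h n : (2 * k < n)%N -> 0 <= (fib_gap k n)%:~R * x ^+ n.
  by move=> kn; rewrite mulr_ge0 // ler0z fib_gap_ge0.
have h5 : 0 < (fib_gap k (2 * k).+1.+4)%:~R * x ^+ (2 * k).+1.+4.
  by rewrite mulr_gt0 ?exprn_gt0 // ltr0z; have := fib_gap_gt0 k; rewrite !addnS addn0.
rewrite !gap_sumS; move: h5.
have := h (2 * k).+1 ltac:(lia); have := h (2 * k).+2 ltac:(lia).
have := h (2 * k).+3 ltac:(lia); have := h (2 * k).+4 ltac:(lia).
by lra.
Qed.

End FibGapSeries.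

(** * The range of x and the final inequality *)

Lemma golden_ratio_bound (R : realType) (x : R) :
  0 < x -> x < golden_ratio R - 1 -> 0 < 1 - x - x ^+ 2.
Proof.
rewrite /golden_ratio => x0 xlt.
have s0 : 0 <= Num.sqrt (5 : R) by exact: sqrtr_ge0.
have s2 : Num.sqrt (5 : R) ^+ 2 = 5 by rewrite sqr_sqrtr.
have h : 2 * x + 1 < Num.sqrt (5 : R) by lra.
(* Completing the square: 5 - (2x+1)^2 = 4 (1 - x - x^2). *)
have : (2 * x + 1) ^+ 2 < Num.sqrt (5 : R) ^+ 2 by rewrite ltr_pXn2r ?nnegrE //; lra.
by rewrite s2; lra.
Qed.

Theorem theorem7 (R : realType) (k : nat) (x : R)
    (x_gt0 : 0 < x) (x_lt : x < golden_ratio R - 1) :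
  [/\ cvgn (partial_prod x), cvgn (partial_sum x) &
      2 * limn (partial_prod x) - limn (partial_sum x)
      < 1 / (x ^ (k%:Z - 1) * (1 + x) ^+ k * (1 - x - x ^+ 2))
        - 1 / (x ^+ k * (1 + x) ^+ k)
          * \sum_(0 <= n < (2 * k).+1) ((fib n)%:Z - Snk n k)%:~R * x ^+ n].
Proof.
have x_small := golden_ratio_bound x_gt0 x_lt.
have [cp _] := partial_prod_cvg_le x_gt0 x_small (ltn0Sn 0).
split=> //; first exact: partial_sum_cvg.
have c_gt0 : 0 < x ^+ k * (1 + x) ^+ k by rewrite mulr_gt0 // exprn_gt0 // addr_gt0.
rewrite -(ltr_pM2l c_gt0).
(* The truncation includes n = 2k+5, where the gap is strictly positive; dropping the terms beyond
   2k then gives strictness. *)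
have kM : (2 * k < (2 * k).+1.+4.+1)%N by lia.
apply: le_lt_trans (gap_sum_bound x_gt0 x_small kM) _.
have := gap_sum_lt x_gt0 x_small k; rewrite -ltrN2 -(ltrD2l (x / (1 - x - x ^+ 2))).
move=> /lt_le_trans; apply; rewrite le_eqVlt; apply/orP; left; apply/eqP.
(* The integer power [x ^ (k%:Z - 1)] is split as [x ^+ k / x], which also covers k = 0. *)
rewrite -/(gap_sum x k _) expfzDr ?gt_eqF // -exprnP exprN1.
have xk : x ^+ k != 0 by rewrite gt_eqF // exprn_gt0.
have xk1 : (1 + x) ^+ k != 0 by rewrite gt_eqF // exprn_gt0 // addr_gt0.
by field; rewrite xk xk1 !gt_eqF.
Qed.
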